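(* Let $S$ be a finite sphere-like poset of rank $k\geq 2$. Suppose that for every $z\in S$ with $\operatorname{rk}(z)=k-2$, the number of elements of $S$ that cover $z$ is even. Then the maximum ranked elements of $S$ admit a proper $2$-colouring: there is a function $\psi:S_k\to\mathbb{Z}_2$, where $S_k=\{x\in S:\operatorname{rk}(x)=k\}$, such that $\psi(x_1)\neq\psi(x_2)$ whenever $x_1,x_2\in S_k$ are adjacent.
   Context: A ranked poset is a poset $S$ with a function $\operatorname{rk}:S\to\mathbb{N}\cup\{0\}$ such that $x<y$ implies $\operatorname{rk}(x)<\operatorname{rk}(y)$ and $x\lessdot y$ ($y$ covers $x$, i.e. $x<y$ with no $z$ satisfying $x<z<y$) implies $\operatorname{rk}(y)=\operatorname{rk}(x)+1$; elements covering nothing have rank $0$. The rank of $S$ is $\max\{\operatorname{rk}(x):x\in S\}$. For $x\in S$, $\Delta(x)=\{z: z\lessdot x\}$ and $\nabla(x)=\{y: x\lessdot y\}$. Two elements $x_1,x_2$ of the same rank are adjacent if $\Delta(x_1)\cap\Delta(x_2)\neq\emptyset$. A matching on $S$ is a set $\mathcal{M}$ of ordered pairs $(x,y)$ with $x\lessdot y$, each element of $S$ lying in at most one pair. An $\mathcal{M}$-path is a sequence $y_0,x_1,y_1,\ldots,x_r,y_r$ ($r\geq 0$) with $(x_i,y_i)\in\mathcal{M}$ and $x_i\lessdot y_{i-1}$, $y_{i-1}\neq y_i$ for each $i$. $\mathcal{M}$ is acyclic if there is no $\mathcal{M}$-path with $r>0$ and $y_r=y_0$ (equivalently, reversing the matched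 edges in the directed Hasse diagram leaves it acyclic). An element is $\mathcal{M}$-critical if it lies in no pair of $\mathcal{M}$. A ranked poset $S$ of rank $k\geq 2$ is sphere-like if: (i) each element of rank $k-1$ is covered by exactly two elements; (ii) for each $y$ of rank $k$ and $z$ of rank $k-2$, the number of $x$ of rank $k-1$ with $z\lessdot x\lessdot y$ is even; (iii) there exists an acyclic matching $\mathcal{M}$ on $S$ such that no element of rank $k-1$ is $\mathcal{M}$-critical. *)

(* Defs.v *)
From HB Require Import structures.
From mathcomp Require Import all_boot all_order all_algebra.

Set Implicit Arguments.
Unset Strict Implicit.
Unset Printing Implicit Defensive.

Section RankedPosets.

Variables (d : Order.disp_t) (S : finPOrderType d).
Implicit Types (x y z : S) (rk : S -> nat) (M : {set S * S}).

Definition covered_by x y : bool :=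
  (x < y)%O && [forall z, ~~ ((x < z)%O && (z < y)%O)].

Definition Delta x : {set S} := [set z | covered_by z x].
Definition Nabla x : {set S} := [set y | covered_by x y].

Record is_rank_function rk : Prop := IsRankFunction {
  rank_lt : forall x y, (x < y)%O -> rk x < rk y;
  rank_cover : forall x y, covered_by x y -> rk y = (rk x).+1;
  rank_minimal : forall x, Delta x = set0 -> rk x = 0
}.

(* The rank of the empty poset is 0 by convention. *)
Definition poset_rank rk : nat := \max_(x : S) rk x.

(* Adjacency is a relation between two distinct elements: without x1 != x2,
   every element with nonempty Delta would be adjacent to itself. *)
Definition adjacent rk x1 x2 : bool :=
  [&& x1 != x2, rk x1 == rk x2 & Delta x1 :&: Delta x2 != set0].

Record is_matching M : Prop := IsMatching {
  matching_cover : forall x y, (x, y) \in M -> covered_by x y;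
  matching_disjoint :
    forall z, #|[set p in M | (z == p.1) || (z == p.2)]| <= 1
}.

(* M_path M y0 [:: (x1, y1); ...; (xr, yr)] : y0, x1, y1, ..., xr, yr is an
   M-path; it ends at last y0 (unzip2 s). *)
Fixpoint M_path M (y0 : S) (s : seq (S * S)) : bool :=
  if s is (x, y) :: s' then
    [&& (x, y) \in M, covered_by x y0, y0 != y & M_path M y s']
  else true.

Definition acyclic M : Prop :=
  forall (y0 : S) (s : seq (S * S)),
    M_path M y0 s -> 0 < size s -> last y0 (unzip2 s) <> y0.

Definition critical M z : Prop :=
  forall x y, (x, y) \in M -> z <> x /\ z <> y.

Record sphere_like rk (k : nat) : Prop := SphereLike {
  sphere_like_ranked : is_rank_function rk;
  sphere_like_rank : poset_rank rk = k;
  sphere_like_rank_ge2 : 2 <= k;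
  sphere_like_two_covers : forall x, rk x = k - 1 -> #|Nabla x| = 2;
  sphere_like_even : forall y z, rk y = k -> rk z = k - 2 ->
    ~~ odd #|[set x | [&& rk x == k - 1, covered_by z x & covered_by x y]]|;
  sphere_like_matching : exists M : {set S * S},
    [/\ is_matching M, acyclic M & forall x, rk x = k - 1 -> ~ critical M x]
}.

End RankedPosets.

(* Main.v *)
Require Import Defs.
From HB Require Import structures.
From mathcomp Require Import all_boot all_order all_algebra.

(** Over [F_2], let [A] be the incidence matrix between ranks [k - 1] and [k],
    and [B] the one between ranks [k - 2] and [k - 1].  A proper 2-colouring is
    a solution of [A psi = 1], since every [x] of rank [k - 1] is covered by
    exactly two elements.  Condition (ii) says [B A = 0], and the hypothesis on
    rank [k - 2] says [B 1 = 0].  An acyclic matching makes the square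
    submatrices of [A] and [B] indexed by matched pairs unitriangular.  Hence
    [A psi = 1] can be solved in the rows matched upwards; the defect
    [w = 1 - A psi] is then supported on elements matched downwards and
    satisfies [B w = 0], so [w = 0]. *)

Set Implicit Arguments.
Unset Strict Implicit.
Unset Printing Implicit Defensive.
Import GRing.Theory.
Local Open Scope ring_scope.

Section Matchings.

Variables (d : Order.disp_t) (S : finPOrderType d) (M : {set S * S}).
Implicit Types x y z : S.

(** One step of an [M_path] with the intermediate element hidden, so that [path] and [connect]
    apply. *)
Definition M_step y y' : bool :=
  [exists x, [&& (x, y') \in M, covered_by x y & y != y']].

Lemma M_step_path y p :
  path M_step y p -> exists2 s, M_path M y s & unzip2 s = p.
Proof.
elim: p y => [|y' p IHp] y /=; first by exists [::].
case/andP=> /existsP[x /and3P[Mxy' xy yy']] /IHp[s Ms <-].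
by exists ((x, y') :: s) => //=; rewrite Mxy' xy yy'.
Qed.

Lemma M_step_connectN y y' :
  acyclic M -> M_step y y' -> ~~ connect M_step y' y.
Proof.
move=> acM yy'; apply/connectP => -[p y'p ey].
have /M_step_path[s Ms es] : path M_step y (y' :: p) by rewrite /= yy'.
apply: (acM y s Ms); last by rewrite es /= -ey.
by rewrite -(size_map snd) -/unzip2 es.
Qed.

(** Acyclicity keeps [y] out of the reach of [y']. The size of the reach is the order that makes the
    matched submatrices triangular. *)
Lemma M_step_reach y y' :
  acyclic M -> M_step y y' ->
  (#|connect M_step y'| < #|connect M_step y|)%N.
Proof.
move=> acM yy'; apply/proper_card/properP; split.
  by apply/subsetP=> u; apply: connect_trans; apply: connect1.
by exists y; [apply: connect0 | apply: M_step_connectN].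
Qed.

Definition cover_sum (V : zmodType) (f : S -> V) x : V :=
  \sum_(y in Nabla x) f y.

(** Take [y0] of largest reach in the support of [w], and its lower partner [x]. Another support
    element covering [x] would step to [y0] and so reach more; hence the sum at [x] is [w y0]
    alone. *)
Lemma cover_sum_eq0 (V : zmodType) (w : S -> V) :
    is_matching M -> acyclic M ->
    (forall y, w y != 0 -> exists2 x, (x, y) \in M & cover_sum w x = 0) ->
  forall y, w y = 0.
Proof.
move=> matM acM hw y; apply/eqP/negPn/negP => wy.
pose h u := #|connect M_step u|.
have [y0 wy0 y0max] := @arg_maxnP S y (fun u => w u != 0) h wy.
have [x Mxy0 sum0] := hw _ wy0.
have xy0 : y0 \in Nabla x by rewrite inE; apply: (matching_cover matM).
have [y1 /and3P[xy1 y10 wy1]|noy1] :=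
  pickP (fun u => [&& u \in Nabla x, u != y0 & w u != 0]).
  have : M_step y1 y0.
    by apply/existsP; exists x; move: xy1; rewrite inE Mxy0 y10 => ->.
  move/(M_step_reach acM); rewrite ltnNge => /negP; apply; exact: y0max.
move: sum0; rewrite /cover_sum (bigD1 y0) //= big1 ?addr0.
  by move=> wy0_0; rewrite wy0_0 eqxx in wy0.
move=> u /andP[xu uy0]; move: (noy1 u).
by rewrite xu uy0 /= => /negbFE/eqP.
Qed.

Lemma matching_inj x x' y :
  is_matching M -> (x, y) \in M -> (x', y) \in M -> x = x'.
Proof.
move=> matM Mxy Mx'y.
have /card_le1_eqP/(_ (x, y) (x', y)) := matching_disjoint matM y.
by rewrite !inE Mxy Mx'y /= eqxx !orbT => /(_ isT isT) [].
Qed.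

Lemma cover_sum_solve (V : finZmodType) (v : S -> V) :
    is_matching M -> acyclic M ->
  exists psi : S -> V, forall x y, (x, y) \in M -> cover_sum psi x = v x.
Proof.
move=> matM acM.
pose partner y := [pick x | (x, y) \in M].
(* Copying the coordinates without a lower partner makes the system square. [F] is additive with
   trivial kernel, so it is bijective by finiteness. *)
pose F (psi : {ffun S -> V}) : {ffun S -> V} :=
  [ffun y => if partner y is Some x then cover_sum psi x else psi y].
have Finj : injective F.
  move=> f g Ffg; apply/ffunP => y; apply/eqP; rewrite -subr_eq0; apply/eqP.
  apply: (cover_sum_eq0 (w := fun u => f u - g u)) y => // y.
  move/ffunP/(_ y): Ffg; rewrite !ffunE /partner.
  case: pickP => [x Mxy fg _|_ ->]; last by rewrite subrr eqxx.
  by exists x => //; rewrite /cover_sum sumrB [X in X - _]fg subrr.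
pose g := [ffun y => if partner y is Some x then v x else 0].
have [F' _ F'K] := injF_bij Finj.
exists (F' g) => x y Mxy; have /ffunP/(_ y) := F'K g.
rewrite !ffunE /partner; case: pickP => [x' Mx'y|/(_ x)]; last by rewrite Mxy.
by rewrite (matching_inj matM Mx'y Mxy).
Qed.

End Matchings.

Lemma natr_Z2_even n : ~~ odd n -> n%:R = 0 :> 'Z_2.
Proof. by move=> evn; rewrite -Zp_nat_mod // modn2 (negPf evn). Qed.

Lemma cover_sum_eq1 (d : Order.disp_t) (S : finPOrderType d)
    (rk : S -> nat) (k : nat) :
    sphere_like rk k ->
    (forall z : S, rk z = (k - 2)%N -> ~~ odd #|Nabla z|) ->
  exists psi : S -> 'Z_2, forall x, rk x = (k - 1)%N -> cover_sum psi x = 1.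
Proof.
move=> hS heven.
have [rkS _ k2 _ even_int [M [matM acM noncrit]]] := hS.
have [psi psiM] := cover_sum_solve (fun=> 1 : 'Z_2) matM acM.
(* The defect, extended by zero so that [cover_sum_eq0] applies on all of [S]. *)
pose w x : 'Z_2 := if rk x == (k - 1)%N then 1 - cover_sum psi x else 0.
have Bw z : rk z = (k - 2)%N -> cover_sum w z = 0.
  move=> rkz.
  have rkup x : x \in Nabla z -> rk x = (k - 1)%N.
    rewrite inE => /(rank_cover rkS) ->; rewrite rkz.
    by rewrite -subSn // subSS.
  rewrite /cover_sum (eq_bigr (fun x => 1 - cover_sum psi x)); last first.
    by move=> x /rkup rkx; rewrite /w rkx eqxx.
  rewrite sumrB sumr_const natr_Z2_even ?heven // sub0r; apply/eqP.
  rewrite oppr_eq0; apply/eqP; rewrite /cover_sum.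
  (* The coefficient of [psi y] counts the [x] between [z] and [y]: even by condition (ii) if [y]
     has rank [k], and zero otherwise. *)
  rewrite (exchange_big_dep predT) //= big1 // => y _.
  rewrite sumr_const -mulr_natr.
  have [rky|rky] := eqVneq (rk y) k.
    rewrite [_%:R]natr_Z2_even ?mulr0 //.
    have := even_int y z rky rkz; congr (~~ odd _).
    apply: eq_card => x; rewrite !inE unfold_in /= !inE.
    case zx: (covered_by z x); rewrite ?andbF //=.
    by rewrite rkup ?inE // eqxx.
  rewrite (_ : #|_| = 0%N) ?mulr0 //; apply: eq_card0 => x.
  rewrite unfold_in /=; apply/negP => /andP[/rkup rkx].
  rewrite inE => /(rank_cover rkS); rewrite rkx => rkyE; case/eqP: rky.
  by rewrite rkyE subn1 prednK // (leq_trans _ k2).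
have w0 : forall x, w x = 0.
  apply: (cover_sum_eq0 matM acM) => x wx.
  have /eqP rkx : rk x == (k - 1)%N
    by apply: contraNT wx => /negPf; rewrite /w => ->.
  (* As [x] is not critical, it has a lower partner, where [Bw] applies, or an upper one, which
     forces [w x = 0]. *)
  have [z Mzx|nz] := pickP (fun z => (z, x) \in M).
    exists z => //; apply: Bw.
    have := rank_cover rkS (matching_cover matM Mzx); rewrite rkx.
    by rewrite subn1 subn2 => ->.
  have [y Mxy|ny] := pickP (fun y => (x, y) \in M).
    by move: wx; rewrite /w rkx eqxx (psiM _ _ Mxy) subrr eqxx.
  case: (noncrit x rkx) => a b Mab; split=> xE.
    by have := ny b; rewrite xE Mab.
  by have := nz a; rewrite xE Mab.
exists psi => x rkx; have := w0 x; rewrite /w rkx eqxx => /eqP.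
by rewrite subr_eq0 eq_sym => /eqP.
Qed.

Local Close Scope ring_scope.

Theorem theorem1p4 (d : Order.disp_t) (S : finPOrderType d)
    (rk : S -> nat) (k : nat)
    (hS : sphere_like rk k)
    (heven : forall z : S, rk z = k - 2 -> ~~ odd #|Nabla z|) :
  exists psi : {x : S | rk x == k} -> 'Z_2,
    forall x1 x2 : {x : S | rk x == k},
      adjacent rk (val x1) (val x2) -> psi x1 <> psi x2.
Proof.
have [psi psi1] := cover_sum_eq1 hS heven.
have [rkS _ _ two_covers _ _] := hS.
exists (fun y => psi (val y)) => y1 y2.
case/and3P=> y12 _ /set0Pn[x]; rewrite !inE => /andP[xy1 xy2].
have rkx : rk x = k - 1.
  have := rank_cover rkS xy1; rewrite (eqP (valP y1)) => ->.
  by rewrite subn1.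
move=> psi12.
have NablaE : Nabla x = [set val y1; val y2].
  apply/esym/eqP; rewrite eqEcard two_covers // cards2 y12 andbT.
  by apply/subsetP => y; rewrite !inE => /orP[]/eqP->.
(* Two equal values sum to 0 in ['Z_2], not to 1. *)
have := psi1 x rkx; rewrite /cover_sum NablaE big_setU1 ?inE //= big_set1 psi12.
by rewrite -mulr2n -mulr_natr natr_Z2_even // mulr0.
Qed.
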